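(* Let $G$ be a graph with vertex set $[2m]=\{1,\dots,2m\}$. The following conditions are equivalent. (1) There exist two minimum vertex covers $O$ and $E$ of $G$ such that $O\cap E=\emptyset$, $O\cup E=[2m]$, and $|O|=|E|=m$. (2) The graph $G$ is bipartite and has a perfect matching. (3) There exists a partition $[2m]=X\sqcup Y$ such that $X$ and $Y$ are independent sets of $G$, $|X|=|Y|=m$, and, after writing $X=\{x_1,\dots,x_m\}$ and $Y=\{y_1,\dots,y_m\}$ in a suitable order, one has $\{x_i,y_i\}\in E(G)$ for every $i=1,\dots,m$.
   Context: Graphs are finite and simple and have at least one edge; $E(G)$ denotes the edge set of $G$. A vertex cover of $G$ is a set of vertices meeting every edge; a minimum vertex cover is a vertex cover of minimum cardinality. An independent set is a set of vertices containing no edge. *)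

(* Defs.v *)
From mathcomp Require Import all_boot.
Set Implicit Arguments. Unset Strict Implicit. Unset Printing Implicit Defensive.

Record sgraph (T : finType) := SGraph {
  edges : {set {set T}};
  edges_card2 : forall e : {set T}, e \in edges -> #|e| = 2
}.

Definition vertex_cover (T : finType) (G : sgraph T) (C : {set T}) : Prop :=
  forall e : {set T}, e \in edges G -> e :&: C != set0.

Definition min_vertex_cover (T : finType) (G : sgraph T) (C : {set T}) : Prop :=
  vertex_cover G C /\ forall D : {set T}, vertex_cover G D -> #|C| <= #|D|.

Definition independent (T : finType) (G : sgraph T) (S : {set T}) : Prop :=
  forall e : {set T}, e \in edges G -> ~~ (e \subset S).

Definition bipartite (T : finType) (G : sgraph T) : Prop :=
  exists A B : {set T},
    [/\ A :&: B = set0, A :|: B = [set: T] &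
        forall e : {set T}, e \in edges G ->
          exists a b : T, [/\ a \in A, b \in B & e = [set a; b]]].

Definition matching (T : finType) (G : sgraph T) (M : {set {set T}}) : Prop :=
  M \subset edges G /\ trivIset M.

Definition has_perfect_matching (T : finType) (G : sgraph T) : Prop :=
  exists M : {set {set T}}, matching G M /\ cover M = [set: T].

(* Main.v *)
(** In a bipartite graph every edge of a perfect matching has exactly one end
    in each class, so both classes have as many vertices as the matching has
    edges, and every vertex cover has at least that many.  Conversely, if [O]
    and [E] are complementary minimum vertex covers and [S] is contained in
    [O], then replacing [S] by its neighbourhood [N(S)] turns [O] into another
    vertex cover; minimality gives [#|S| <= #|N(S)|], and Hall's marriage
    theorem matches [O] into [E]. *)
Require Import Defs.
From mathcomp Require Import all_boot.
Set Implicit Arguments. Unset Strict Implicit. Unset Printing Implicit Defensive.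

Definition neighbours (T U : finType) (N : T -> {set U}) (S : {set T}) : {set U} :=
  \bigcup_(x in S) N x.

Lemma neighboursU (T U : finType) (N : T -> {set U}) (S S' : {set T}) :
  neighbours N (S :|: S') = neighbours N S :|: neighbours N S'.
Proof. exact: bigcup_setU. Qed.

Lemma neighboursD (T U : finType) (N : T -> {set U}) (Z : {set U}) (S : {set T}) :
  neighbours (fun x => N x :\: Z) S = neighbours N S :\: Z.
Proof.
apply/setP=> u; rewrite in_setD; apply/bigcupP/andP.
  by case=> x xS; rewrite in_setD => /andP[uZ uN]; split=> //; apply/bigcupP; exists x.
by case=> uZ /bigcupP[x xS uN]; exists x => //; rewrite in_setD uZ.
Qed.

(** The set [Z] separates the values: [f] stays inside it on [S] and [g] avoids it elsewhere, so
    gluing creates no collision. Hall's theorem uses it with [Z] the neighbourhood of a tight set,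
    or a single matched vertex. *)
Lemma hall_merge (T : finType) (N : T -> {set T}) (S A Z : {set T})
    (f g : T -> T) :
  {in S &, injective f} -> {in S, forall x, f x \in N x :&: Z} ->
  {in A :\: S &, injective g} -> {in A :\: S, forall x, g x \in N x :\: Z} ->
  exists2 h : T -> T, {in A &, injective h} & {in A, forall x, h x \in N x}.
Proof.
move=> fI fN gI gN; exists (fun x => if x \in S then f x else g x).
  move=> x y xA yA; case: ifPn => xS; case: ifPn => yS; first exact: fI.
  - move=> e; have := fN _ xS; have := gN y; rewrite !inE yS yA => /(_ isT).
    by rewrite e => /andP[/negbTE-> _]; rewrite andbF.
  - move=> e; have := fN _ yS; have := gN x; rewrite !inE xS xA => /(_ isT).
    by rewrite e => /andP[/negbTE-> _]; rewrite andbF.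
  by apply: gI; rewrite !inE ?xS ?yS.
move=> x xA; case: ifPn => xS; first by have := fN _ xS; rewrite inE => /andP[].
by have := gN x; rewrite !inE xS xA => /(_ isT)/andP[].
Qed.

(* Halmos and Vaughan: either some proper nonempty [S] is tight, and [S] and
   [A :\: S] can be matched separately, or no [S] is tight, and any single pair
   can be matched first. *)
Theorem hall (T : finType) (N : T -> {set T}) (A : {set T}) :
  (forall S : {set T}, S \subset A -> #|S| <= #|neighbours N S|) ->
  exists2 f : T -> T, {in A &, injective f} & {in A, forall x, f x \in N x}.
Proof.
(* Induction on a bound for [#|A|]; [N] is generalised too, since used vertices get deleted from the
   neighbourhoods. *)
have [n] := ubnP #|A|; elim: n N A => // n IHn N A; rewrite ltnS => leAn hallA.
have [A0|[x xA]] := set_0Vmem A.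
  by exists id => [u v|u]; rewrite A0 inE.
have [tight|slack] := boolP [exists S : {set T},
    [&& S \proper A, S != set0 & #|neighbours N S| <= #|S|]].
  have {tight} [S /and3P[pSA S0 leNS]] := existsP tight.
  have sSA := proper_sub pSA.
  have [||f fI fN] := IHn N S.
  - exact: leq_trans (proper_card pSA) leAn.
  - by move=> S' sS'; apply: hallA; apply: subset_trans sSA.
  have [||g gI gN] := IHn (fun x => N x :\: neighbours N S) (A :\: S).
  - apply: leq_trans leAn; rewrite cardsD (setIidPr sSA) ltn_subrL.
    by rewrite card_gt0 S0 (leq_trans _ (subset_leq_card sSA)) ?card_gt0.
  - move=> S' sS'; rewrite neighboursD.
    have /andP[sS'A dS'S] : (S' \subset A) && [disjoint S' & S] by rewrite -subsetD.
    (* Hall's condition for the disjoint union [S :|: S'], less the tight bound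
       [#|neighbours N S| <= #|S|], is the condition for [S'] outside [neighbours N S]. *)
    have := hallA (S :|: S'); rewrite subUset sSA => /(_ sS'A).
    rewrite neighboursU !cardsU (disjoint_setI0 _) 1?disjoint_sym // cards0 subn0.
    rewrite cardsD setIC -addnBA ?subset_leq_card ?subsetIl //.
    rewrite [neighbours N S' :&: _]setIC.
    move=> h; rewrite -(leq_add2l #|S|); apply: leq_trans h _.
    by rewrite leq_add2r.
  apply: hall_merge fI _ gI gN => u uS; rewrite inE fN //=.
  by apply/bigcupP; exists u => //; apply: fN.
have [y yN] : exists y, y \in N x.
  have := hallA [set x]; rewrite sub1set xA cards1 /neighbours big_set1 => /(_ isT).
  by rewrite card_gt0 => /set0Pn.
have [||g gI gN] := IHn (fun x => N x :\: [set y]) (A :\: [set x]).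
- by apply: leq_trans leAn; rewrite [leqRHS](cardsD1 x) xA.
- move=> S sSA; rewrite neighboursD; have [->|S0] := eqVneq S set0.
    by rewrite cards0.
  have pSA : S \proper A.
    by apply: sub_proper_trans sSA _; apply: properD1.
  (* Without tight sets Hall's inequality is strict on [S], so it survives the loss of the single
     vertex [y]. *)
  move/existsPn: slack => /(_ S); rewrite pSA S0 /= -ltnNge.
  rewrite [#|neighbours N S|](cardsD1 y) => ltS; rewrite -ltnS.
  by apply: leq_trans ltS _; rewrite -add1n leq_add2r leq_b1.
apply: (@hall_merge _ N [set x] A [set y] (fun=> y) g) => //.
  by move=> u v /set1P-> /set1P->.
by move=> u /set1P->; rewrite !inE yN eqxx.
Qed.

Lemma independent_setC (T : finType) (G : sgraph T) (C S : {set T}) :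
  C :&: S = set0 -> vertex_cover G C -> independent G S.
Proof.
move=> CS coverC e eG; apply/negP=> sub; case/negP: (coverC e eG).
by rewrite -subset0 -CS subsetI subsetIr (subset_trans (subsetIl _ _)).
Qed.

Lemma vertex_cover_setC (T : finType) (G : sgraph T) (C S : {set T}) :
  C :|: S = [set: T] -> independent G S -> vertex_cover G C.
Proof.
move=> CS indS e eG; have [u ue uS] := subsetPn (indS e eG).
apply/set0Pn; exists u; rewrite inE ue.
by have := in_setT u; rewrite -CS inE (negbTE uS) orbF.
Qed.

(** An edge meets both covers; as these are disjoint, the two ends found differ, and an edge has
    only two. *)
Lemma bipartite_edge (T : finType) (G : sgraph T) (A B : {set T}) :
  vertex_cover G A -> vertex_cover G B -> A :&: B = set0 ->
  forall e, e \in edges G -> exists a b, [/\ a \in A, b \in B & e = [set a; b]].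
Proof.
move=> cA cB AB e eG.
have /set0Pn[a /setIP[ae aA]] := cA e eG; have /set0Pn[b /setIP[be bB]] := cB e eG.
exists a, b; split=> //; apply/esym/eqP; rewrite eqEcard (edges_card2 eG) cards2.
rewrite subUset !sub1set ae be /=; case: eqVneq => // ab.
by move: (in_set0 a); rewrite -AB inE aA ab bB.
Qed.

(** The matching edges partition the vertices, so [C] can be counted edge by edge. Each summand is 1
    when [C] is a class of a bipartition and at least 1 when [C] is a cover. *)
Lemma card_perfect_matching (T : finType) (M : {set {set T}}) (C : {set T}) :
  trivIset M -> cover M = [set: T] -> #|C| = \sum_(e in M) #|e :&: C|.
Proof.
move=> tM cM; rewrite -sum1_card.
transitivity (\sum_(u in cover M) (u \in C : nat)).
  by rewrite cM [RHS](eq_bigl predT) ?big_mkcond // => u; rewrite inE.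
rewrite big_trivIset //=; apply: eq_bigr => e _.
rewrite -sum1_card [RHS]big_mkcond [LHS]big_mkcond; apply: eq_bigr => u _.
by rewrite inE; case: (u \in e).
Qed.

Lemma perfect_matching_class (T : finType) (G : sgraph T) (M : {set {set T}})
    (A B : {set T}) :
  matching G M -> cover M = [set: T] -> A :&: B = set0 ->
  (forall e, e \in edges G -> exists a b, [/\ a \in A, b \in B & e = [set a; b]]) ->
  min_vertex_cover G A /\ #|A| = #|M|.
Proof.
move=> [sMG tM] cM AB eAB.
have cardA : #|A| = #|M|.
  rewrite (card_perfect_matching A tM cM) -sum1_card; apply: eq_bigr => e eM.
  have [a [b [aA bB ->]]] := eAB e (subsetP sMG e eM).
  rewrite (_ : _ :&: A = [set a]) ?cards1 //; apply/setP=> u; rewrite !inE.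
  have bA : b \in A = false by have := in_set0 b; rewrite -AB inE bB andbT.
  by case: (eqVneq u a) => [->|_] //=; case: eqVneq => // ->.
split=> //; split=> [e /eAB[a [b [aA _ ->]]]|D cD].
  by apply/set0Pn; exists a; rewrite !inE eqxx.
rewrite cardA (card_perfect_matching D tM cM) -sum1_card; apply: leq_sum => e eM.
by rewrite card_gt0; apply: cD; apply: (subsetP sMG).
Qed.

Lemma min_vertex_cover_hall (T : finType) (G : sgraph T) (A B : {set T}) :
  min_vertex_cover G A -> vertex_cover G B -> A :&: B = set0 ->
  exists2 f : T -> T, {in A &, injective f} &
    {in A, forall a, f a \in B /\ [set a; f a] \in edges G}.
Proof.
move=> [cA minA] cB AB.
pose N a := [set b in B | [set a; b] \in edges G].
have [|f fI fN] := @hall _ N A.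
  move=> S sSA; have /minA : vertex_cover G ((A :\: S) :|: neighbours N S).
    move=> e eG; have [a [b [aA bB eE]]] := bipartite_edge cA cB AB eG.
    apply/set0Pn; have [aS|aS] := boolP (a \in S).
      exists b; rewrite eE !inE eqxx orbT /=; apply/orP; right.
      by apply/bigcupP; exists a => //; rewrite inE bB -eE.
    by exists a; rewrite eE !inE eqxx aS aA.
  (* Bounding the size of the union by the sum of sizes and cancelling [#|A :\: S|] leaves Hall's
     inequality for [S]. *)
  rewrite -(cardsID S A) (setIidPr sSA) cardsU => h.
  by have := leq_trans h (leq_subr _ _); rewrite addnC leq_add2l.
by exists f => // a /fN; rewrite inE => /andP[].
Qed.

Theorem proposition3p16 (m : nat) (G : sgraph 'I_(2 * m))
    (G_edge : edges G != set0) :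
  let cond1 :=
    exists O E : {set 'I_(2 * m)},
      [/\ min_vertex_cover G O /\ min_vertex_cover G E,
          O :&: E = set0, O :|: E = [set: 'I_(2 * m)], #|O| = m & #|E| = m] in
  let cond2 := bipartite G /\ has_perfect_matching G in
  let cond3 :=
    exists X Y : {set 'I_(2 * m)},
      [/\ X :&: Y = set0 /\ X :|: Y = [set: 'I_(2 * m)],
          independent G X /\ independent G Y,
          #|X| = m, #|Y| = m &
          exists x y : 'I_m -> 'I_(2 * m),
            [/\ injective x, injective y,
                X = [set x i | i : 'I_m], Y = [set y i | i : 'I_m] &
                forall i : 'I_m, [set x i; y i] \in edges G]] in
  (cond1 <-> cond2) /\ (cond2 <-> cond3).
Proof.
move=> cond1 cond2 cond3.
(* Both equivalences follow from the cycle [cond1 -> cond3 -> cond2 -> cond1]. *)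
have c13 : cond1 -> cond3.
  case=> O [E [[mO [cE _]] OE OUE cardO cardE]]; have [cO _] := mO.
  exists O, E; split=> //.
    by split; [apply: independent_setC cE; rewrite setIC | apply: independent_setC cO].
  have [f fI fN] := min_vertex_cover_hall mO cE OE.
  pose x (i : 'I_m) : 'I_(2 * m) := enum_val (cast_ord (esym cardO) i).
  have xO i : x i \in O by apply: enum_valP.
  have xI : injective x by move=> i j /enum_val_inj/cast_ord_inj.
  have yI : injective (f \o x) by move=> i j /fI e; apply: xI; apply: e.
  exists x, (f \o x); split=> //.
  - apply/esym/eqP; rewrite eqEcard card_imset // card_ord cardO leqnn andbT.
    by apply/subsetP=> _ /imsetP[i _ ->].
  (* The Hall map is injective from [O] into [E], and both have [m] elements, so its image is all of
     [E]. *)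
  - apply/esym/eqP; rewrite eqEcard card_imset // card_ord cardE leqnn andbT.
    by apply/subsetP=> _ /imsetP[i _ ->]; case: (fN _ (xO i)).
  - by move=> i; case: (fN _ (xO i)).
have c32 : cond3 -> cond2.
  case=> X [Y [[XY XUY] [iX iY] cardX cardY [x [y [xI yI XE YE xyG]]]]].
  (* Independence of each class makes the complementary class a cover, which is what
     [bipartite_edge] needs. *)
  have cX := vertex_cover_setC XUY iY.
  have cY : vertex_cover G Y by apply: vertex_cover_setC iX; rewrite setUC.
  split; first by exists X, Y; split=> //; apply: bipartite_edge.
  have xX i : x i \in X by rewrite XE imset_f.
  have yY i : y i \in Y by rewrite YE imset_f.
  have xy i j : (x i == y j) = false.
    by apply/eqP=> e; have := in_set0 (x i); rewrite -XY in_setI xX e yY.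
  exists [set [set x i; y i] | i : 'I_m]; split; [split|].
  - by apply/subsetP=> _ /imsetP[i _ ->].
  - apply/trivIsetP=> _ _ /imsetP[i _ ->] /imsetP[j _ ->] nij.
    have {}nij : i != j by apply: contraNneq nij => ->.
    apply/pred0P=> u; rewrite /= !inE; apply/negP=> /andP[/orP[]/eqP->].
      by rewrite (inj_eq xI) xy (negbTE nij).
    by rewrite (inj_eq yI) eq_sym xy (negbTE nij).
  - apply/setP=> u; rewrite [RHS]inE; apply/bigcupP.
    have : u \in X :|: Y by rewrite XUY inE.
    rewrite XE YE => /setUP[] /imsetP[i _ ->];
      exists [set x i; y i]; by [exact: imset_f | rewrite !inE eqxx ?orbT].
have c21 : cond2 -> cond1.
  case=> [[A [B [AB AUB eAB]]] [M [mM cM]]].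
  have [mA cardA] := perfect_matching_class mM cM AB eAB.
  have [|e|mB cardB] := @perfect_matching_class _ G M B A mM cM.
  - by rewrite setIC.
  - by case/eAB=> a [b [aA bB ->]]; exists b, a; split; rewrite // setUC.
  (* Both classes have [#|M|] elements and together they exhaust the [2 * m] vertices. *)
  have cardM : #|M| = m.
    have := cardsT 'I_(2 * m); rewrite -AUB cardsU AB cards0 subn0 cardA cardB.
    by rewrite card_ord addnn -mul2n => /eqP; rewrite eqn_pmul2l // => /eqP.
  by exists A, B; split; rewrite ?cardA ?cardB.
by split; split; auto.
Qed.
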